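(* For any D-base $A$ of a frame $L$, the distributive envelope $DA$ of $A$ is isomorphic to the sublattice of $L$ generated by $A$.
   Context: A meet-semilattice $A$ (a poset with binary meets, not necessarily bounded) is distributive if $a\wedge b\le c$ implies there are $a'\ge a$, $b'\ge b$ with $a'\wedge b'=c$. A sup-morphism between distributive meet-semilattices is a map preserving binary meets and all existing finite joins. A subset $A$ of a frame $L$ is a base if every element of $L$ is a join of elements of $A$. A base $A$ of $L$ is a D-base if $A$ is a distributive meet-semilattice and the embedding $A\hookrightarrow L$ is a sup-morphism (so binary meets of $A$, and those finite joins that exist in $A$, agree with the ones computed in $L$). Distributive envelope: a filter of $A$ is a nonempty upset closed under binary meets; a filter $P$ is prime if it is a meet-prime element of the lattice of filters (that is, $P\neq A$, and $F\cap G\subseteq P$ implies $F\subseteq P$ or $G\subseteq P$ for all filters $F,G$). Let $X_A$ be the set of prime filters of $A$ and $\mathfrak{s}:A\to\wp(X_A)$, $\mathfrak{s}(a)=\{P\in X_A: a\in P\}$. Then $DA$ is the sublattice of $\wp(X_A)$ generated by $\mathfrak{s}[A]$, i.e. $DA=\{\bigcup_{i=1}^n\mathfrak{s}(a_i): n\ge 1,\ a_1,\dots,a_n\in A\}$. *)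

(* Defs.v *)
From HB Require Import structures.
From mathcomp Require Import all_boot all_order.
From mathcomp Require Import all_classical.
Set Implicit Arguments.
Unset Strict Implicit.
Unset Printing Implicit Defensive.
Import Order.Theory.
Local Open Scope order_scope.
Local Open Scope classical_set_scope.

HB.mixin Record Lattice_isFrame d (L : Type) of Order.Lattice d L := {
  frame_has_sup : forall S : set L, supremums S !=set0;
  frame_meet_sup : forall (a : L) (S : set L) (s : L), supremums S s ->
    supremums [set Order.meet a x | x in S] (Order.meet a s)
}.

#[short(type="frameType")]
HB.structure Definition Frame d := {L of Order.Lattice d L & Lattice_isFrame d L}.

(* The induced order on subtypes, hence on [set_type A] for [A : set T], which
   unfolds to [{x : T | x \in A}]. *)
HB.instance Definition _ d (T : porderType d) (P : pred T) :=
  [SubChoice_isSubPOrder of {x : T | P x} by <: with d].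

Section Semilattices.
Context d (A : porderType d).

Definition is_meet (a b m : A) : Prop := infimums [set a; b] m.

Definition meet_semilattice : Prop := forall a b : A, exists m, is_meet a b m.

Definition distributive_meet_semilattice : Prop :=
  meet_semilattice /\
  forall a b m c : A, is_meet a b m -> m <= c ->
    exists a' b' : A, [/\ a <= a', b <= b' & is_meet a' b' c].

Definition order_filter (F : set A) : Prop :=
  [/\ F !=set0,
      forall a b, F a -> a <= b -> F b &
      forall a b m, is_meet a b m -> F a -> F b -> F m].

Definition prime_filter (P : set A) : Prop :=
  [/\ order_filter P,
      P <> [set: A] &
      forall F G, order_filter F -> order_filter G ->
        F `&` G `<=` P -> F `<=` P \/ G `<=` P].

End Semilattices.

(* "All existing finite joins" includes the empty one: a least element, if any,
   is sent to a least element. *)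
Definition sup_morphism d d' (A : porderType d) (B : porderType d')
    (f : A -> B) : Prop :=
  (forall a b m, is_meet a b m -> is_meet (f a) (f b) (f m)) /\
  (forall (S : set A) (j : A), finite_set S ->
    supremums S j -> supremums [set f x | x in S] (f j)).

Definition frame_base d (L : frameType d) (A : set L) : Prop :=
  forall x : L, exists2 S : set L, S `<=` A & supremums S x.

Definition D_base d (L : frameType d) (A : set L) : Prop :=
  [/\ frame_base A,
      distributive_meet_semilattice (set_type A) &
      sup_morphism (val : set_type A -> L)].

(* Not necessarily bounded, possibly empty. *)
Definition sublattice d (L : latticeType d) (M : set L) : Prop :=
  forall x y, M x -> M y -> M (Order.meet x y) /\ M (Order.join x y).

Definition generated_sublattice d (L : latticeType d) (S : set L) : set L :=
  smallest (@sublattice d L) S.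

Section Envelope.
Context d (A : porderType d).

Definition prime_filters : set (set A) := [set P | prime_filter P].

Definition stone (a : A) : set (set_type prime_filters) := [set P | val P a].

(* The lattice structure on the powerset is given by inclusion. *)
Definition distributive_envelope : set (set (set_type prime_filters)) :=
  generated_sublattice (range stone).

Lemma stone_meet (a b m : A) :
  is_meet a b m -> stone m = stone a `&` stone b.
Proof.
move=> abm; have [lbm _] := abm.
have ma : m <= a by apply: lbm; left.
have mb : m <= b by apply: lbm; right.
apply/seteqP; split=> P; have /set_mem[[_ Pup PI] _ _] := valP P.
  by move=> Pm; split; apply: Pup Pm _.
by move=> [Pa Pb]; apply: (PI _ _ _ abm).
Qed.

Lemma distributive_envelopeE : meet_semilattice A ->
  distributive_envelope =
  [set \bigcup_(a in S) stone a | S in [set S | finite_set S /\ S !=set0]].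
Proof.
move=> msA; apply/seteqP; split; last first.
  move=> _ [S [Sfin S0] <-] M [Msub Mgen].
  move: Sfin S0 => /finite_seqP[[|a s] ->] => [[]//|_].
  elim: s a => [|b s IH] a.
    by rewrite set_cons1 bigcup_set1; apply: Mgen; exists a.
  have -> : [set` [:: a, b & s]] = a |` [set` b :: s].
    apply/seteqP; split=> x /=.
      by rewrite in_cons => /predU1P.
    by rewrite [x \in _ :: _ :: _]in_cons => /predU1P.
  rewrite bigcup_setU1.
  by have [] // := Msub (stone a) _ _ (IH b); apply: Mgen; exists a.
apply: smallest_sub; last first.
  move=> _ [a _ <-]; exists [set a]; last by rewrite bigcup_set1.
  by split; [exact: finite_set1 | exists a].
move=> _ _ [S [Sfin [a Sa]] <-] [T [Tfin [b Tb]] <-]; split; last first.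
  exists (S `|` T); last by rewrite bigcup_setU.
  by split; [rewrite finite_setU | exists a; left].
pose mt (p : A * A) := xget p.1 [set m | is_meet p.1 p.2 m].
have mtP x y : is_meet x y (mt (x, y)).
  by rewrite /mt; case: xgetP => // none; have [m /none] := msA x y.
exists (mt @` (S `*` T)).
  split; first by apply: finite_image; exact: finite_setX.
  by exists (mt (a, b)), (a, b).
apply/seteqP; split=> P.
  move=> [_ [[x y] [/= Sx Ty] <-]].
  by rewrite (stone_meet (mtP x y)) => -[Px Py]; split; [exists x | exists y].
move=> [[x Sx Px] [y Ty Py]].
exists (mt (x, y)); first by exists (x, y).
by rewrite (stone_meet (mtP x y)).
Qed.

End Envelope.

Arguments prime_filters {d} A.
Arguments distributive_envelope {d} A.

(* Isomorphism of the sublattices S of K and T of L; the values of f outside S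
   are irrelevant. *)
Definition lattice_isomorphic d d' (K : latticeType d) (L : latticeType d')
    (S : set K) (T : set L) : Prop :=
  exists f : K -> L,
    [/\ set_bij S T f,
        {in S &, {morph f : x y / Order.meet x y >-> Order.meet x y}} &
        {in S &, {morph f : x y / Order.join x y >-> Order.join x y}}].

(* Main.v *)
Require Import Defs.
From mathcomp Require Import all_boot all_order all_classical.

(** The map from [distributive_envelope] to [L] sends a union of basic sets
[stone b_1], ..., [stone b_n] to the join of [b_1], ..., [b_n] in [L].
Everything rests on one equivalence ([stone_sub_bigcupP]): for [a] and a finite
nonempty family of [b_i] in [A],

  [a <= b_1 \/ ... \/ b_n] in [L]  iff
  [stone a] is included in [stone b_1 `|` ... `|` stone b_n].

- If [a] lies below the join and belongs to a prime filter [P], then every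
  common upper bound of the [b_i] in [A] is above [a], hence in [P]. The common
  upper bounds form the intersection of the principal filters of the [b_i], so
  primeness puts some [b_i] in [P] ([prime_filter_ubound]).
- Conversely, suppose the inclusion holds. No element [u] above all the [b_i]
  fails to be above [a], for otherwise a prime filter containing [a] and not
  [u] ([prime_filter_separation]) would contradict the inclusion. In a
  distributive meet-semilattice this forces [a] to be the join in [A] of the
  meets of [a] with the [b_i] ([meet_le_ubound]). Since the embedding is a
  sup-morphism, [a] is also their join in [L], and so is below the join of the
  [b_i].

Consequently an element [U] of the envelope and the matching [y] in [L] have
the same elements of [A] below them. As [A] is a base, each of [U] and [y]
determines the other, and the correspondence preserves meets; it preserves
joins because suprema of unions are joins of suprema. *)

(** * Finite suprema in a lattice *)

Section FiniteSuprema.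
Local Open Scope order_scope.
Local Open Scope classical_set_scope.
Import Order.Theory.

Lemma finite_nonempty_ind (T : eqType) (Q : set T -> Prop) :
  (forall a, Q [set a]) ->
  (forall a S, finite_set S -> S !=set0 -> Q S -> Q (a |` S)) ->
  forall S, finite_set S -> S !=set0 -> Q S.
Proof.
move=> Q1 QU _ /finite_seqP[[|a s] ->] [b //= _].
elim: s a {b} => [|b s IH] a; first by rewrite set_cons1.
rewrite (_ : [set` [:: a, b & s]] = a |` [set` b :: s]).
  by apply: QU => //; exists b; rewrite /= mem_head.
apply/seteqP; split=> x /=.
  by rewrite in_cons => /predU1P.
by rewrite [x \in _ :: _ :: _]in_cons => /predU1P.
Qed.

Lemma supremumsU {d} {L : latticeType d} (S T : set L) (y z : L) :
  supremums S y -> supremums T z -> supremums (S `|` T) (Order.join y z).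
Proof.
move=> [uS lS] [uT lT]; split=> [x [/uS|/uT] xle|x xub].
- exact: lexUl.
- exact: lexUr.
- rewrite leUx lS ?lT // => t Tt; apply: xub; first by right.
  by left.
Qed.

Lemma finite_sup_generated {d} {L : latticeType d} (A S : set L) (y : L) :
  finite_set S -> S !=set0 -> S `<=` A -> supremums S y ->
  generated_sublattice A y.
Proof.
move=> Sfin S0 SA Sy M [Msub AM].
suff [t Mt St] : exists2 t, M t & supremums S t.
  by rewrite (is_subset1_supremums Sy St).
move: S Sfin S0 SA {y Sy}; apply: finite_nonempty_ind => [a|a S _ _ IH] SA.
  by exists a; [exact/AM/SA|rewrite supremums1].
have [t Mt St] : exists2 t, M t & supremums S t.
  by apply: IH => x Sx; apply: SA; right.
have Ma : M a by apply/AM/SA; left.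
exists (Order.join a t); first by have [] := Msub _ _ Ma Mt.
by apply: supremumsU; rewrite ?supremums1.
Qed.

End FiniteSuprema.

(** * Prime filters of a distributive meet-semilattice *)

Section Filters.
Local Open Scope order_scope.
Local Open Scope classical_set_scope.
Import Order.Theory.
Context {d} {A : porderType d}.
Implicit Types (a b c u v : A) (F G P S : set A).

(** The meet of [a] and [b] is below [v]. Meets are only given by a relation,
and this form avoids naming them; it also says that [v] lies in the filter
generated by [a] and [b]. *)
Definition meet_le a b v : Prop := forall x, x <= a -> x <= b -> x <= v.

Lemma is_meetP a b m :
  is_meet a b m <-> [/\ m <= a, m <= b & meet_le a b m].
Proof.
split=> [[lb gl]|[ma mb ab]].
  split; [by apply: lb; left|by apply: lb; right|].
  by move=> x xa xb; apply: gl => _ [->|->].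
by split=> [_ [->|->] //|x xlb]; apply: ab; apply: xlb; [left|right].
Qed.

Hypothesis dA : distributive_meet_semilattice A.

Lemma meet_exists a b : exists m, [/\ m <= a, m <= b & meet_le a b m].
Proof. by have [m /is_meetP] := dA.1 a b; exists m. Qed.

Lemma meet_le_split {a b v} : meet_le a b v ->
  exists a' b', [/\ a <= a', b <= b', v <= a', v <= b' & meet_le a' b' v].
Proof.
have [m abm] := dA.1 a b; have /is_meetP[ma mb _] := abm => abv.
have [a' [b' [aa' bb' a'b'v]]] := dA.2 a b m v abm (abv m ma mb).
have /is_meetP[va' vb' ?] := a'b'v.
by exists a', b'.
Qed.

(** Upper bounds exist without a top element: splitting [a /\ b <= a] yields
an element above both [b] and [a]. *)
Lemma directed a b : exists c, a <= c /\ b <= c.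
Proof.
have [|_ [c [_ bc _ ac _]]] := @meet_le_split a b a; first by [].
by exists c.
Qed.

(** Distributivity of the filter lattice, for principal filters: [v]
splits along [a] and [b], and the part [w1] above [b] splits again along [a]
and [c]; its part above [c] is also above [w1], hence above [b]. *)
Lemma meet_le_distr {a b c v} : meet_le a b v -> meet_le a c v ->
  exists w, [/\ b <= w, c <= w & meet_le a w v].
Proof.
move=> abv acv.
have [a1 [w1 [aa1 bw1 _ vw1 a1w1v]]] := meet_le_split abv.
have [|a2 [w2 [aa2 cw2 w1a2 w1w2 a2w2]]] := @meet_le_split a c w1.
  by move=> x xa xc; apply: le_trans vw1; apply: acv.
exists w2; split=> //; first exact: le_trans w1w2.
move=> x xa xw2; apply: a1w1v; first exact: le_trans aa1.
by apply: a2w2 => //; exact: le_trans aa2.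
Qed.

(** If [v] is above all the meets of [a] with elements of [S], it is above the
meet of [a] with a single common upper bound of [S]: the finitary form of the
previous lemma, standing in for distribution of [a] over a join that [A] may
not have. *)
Lemma meet_le_ubound S a v : finite_set S -> S !=set0 ->
  (forall b, S b -> meet_le a b v) -> exists2 w, ubound S w & meet_le a w v.
Proof.
move: S; apply: finite_nonempty_ind => [b|b S _ _ IH] Sv.
  by exists b; [rewrite ub_set1|exact: Sv].
have [|w Sw awv] := IH; first by move=> c Sc; apply: Sv; right.
have [|w' [bw' ww' aw'v]] := meet_le_distr (Sv b _) awv; first by left.
by exists w' => // x [->//|/Sw cw]; apply: le_trans ww'.
Qed.

Lemma order_filter_ubound S : finite_set S -> S !=set0 ->
  order_filter (ubound S).
Proof.
move=> Sfin S0; split.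
- move: S Sfin S0; apply: finite_nonempty_ind => [a|a S _ _ [w Sw]].
    by exists a; rewrite ub_set1.
  have [c [ac wc]] := directed a w.
  by exists c => x [->//|/Sw bw]; apply: le_trans wc.
- by move=> a b Sa ab x /Sa xa; apply: le_trans ab.
- move=> a b m /is_meetP[_ _ abm] Sa Sb x Sx.
  by apply: abm; [apply: Sa|apply: Sb].
Qed.

(** [ubound S] is the intersection of the principal filters of the elements of
[S], so this is primeness for finite intersections. *)
Lemma prime_filter_ubound {P S} : prime_filter P -> finite_set S -> S !=set0 ->
  ubound S `<=` P -> exists2 b, S b & P b.
Proof.
move=> [_ _ primeP].
move: S; apply: finite_nonempty_ind => [a|a S Sfin S0 IH] SP.
  by exists a => //; apply: SP; rewrite ub_set1.
have [|||aP|/IH[b Sb Pb]] := primeP (ubound [set a]) (ubound S).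
- by apply: order_filter_ubound; [exact: finite_set1|exists a].
- exact: order_filter_ubound.
- move=> x [xa xS]; apply: SP => z [->|/xS //]; exact: xa.
- by exists a; [left|apply: aP; rewrite ub_set1].
- by exists b => //; right.
Qed.

Lemma principal_filter a : order_filter [set x | a <= x].
Proof.
split; first by exists a => /=.
  by move=> x y /= ax; apply: le_trans.
by move=> x y m /is_meetP[_ _ xym] /= ax ay; apply: xym.
Qed.

(** The filter generated by [P] and [f]. *)
Definition filter_adjoin P f : set A :=
  [set x | exists2 p, P p & meet_le p f x].

Lemma order_filter_adjoin P f :
  order_filter P -> order_filter (filter_adjoin P f).
Proof.
move=> [[p Pp] Pup PI]; split; first by exists f, p.
  move=> x y [q Pq qfx] xy; exists q => // z zq zf.
  by apply: le_trans xy; apply: qfx.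
move=> x y m /is_meetP[_ _ xym] [q Pq qfx] [r Pr rfy].
have [t qrt] := dA.1 q r; exists t; first exact: PI qrt _ _.
have /is_meetP[tq tr _] := qrt => z zt zf; apply: xym.
  by apply: qfx => //; apply: le_trans tq.
by apply: rfy => //; apply: le_trans tr.
Qed.

Lemma sub_filter_adjoin P f : P `<=` filter_adjoin P f.
Proof. by move=> x Px; exists x. Qed.

Lemma filter_adjoin_self P f : P !=set0 -> filter_adjoin P f f.
Proof. by move=> [p Pp]; exists p. Qed.

(** A filter maximal among those avoiding [u] is prime: if [f] and [g] lie
outside [P], then [u] is above [p /\ f] and [p /\ g] for some [p] in [P], hence
above [p /\ w] for some [w] above both [f] and [g]; so [w] is not in [P]. *)
Lemma maximal_filter_prime P u : order_filter P -> ~ P u ->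
  (forall F, order_filter F -> P `<` F -> F u) -> prime_filter P.
Proof.
move=> fP Pu maxP; have [[p0 Pp0] Pup PI] := fP.
have adj f : ~ P f -> filter_adjoin P f u.
  move=> Pf; apply: maxP; first exact: order_filter_adjoin.
  split; first exact: sub_filter_adjoin.
  by move=> adjP; apply/Pf/adjP/filter_adjoin_self; exists p0.
split=> // [PT|F G [_ Fup _] [_ Gup _] FGP]; first by apply: Pu; rewrite PT.
apply: contrapT => /not_orP[/existsNP[f /not_implyP[Ff /adj[p Pp pfu]]]
  /existsNP[g /not_implyP[Gg /adj[q Pq qgu]]]].
have [r pqr] := dA.1 p q; have /is_meetP[rp rq _] := pqr.
have [||w [fw gw rwu]] := @meet_le_distr r f g u.
- by move=> x xr xf; apply: pfu => //; apply: le_trans rp.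
- by move=> x xr xg; apply: qgu => //; apply: le_trans rq.
have Pw : P w by apply: FGP; split; [apply: Fup fw|apply: Gup gw].
have [m rwm] := dA.1 r w; have /is_meetP[mr mw _] := rwm.
by apply: Pu; apply: Pup (rwu _ mr mw); apply: (PI r w) => //; apply: (PI p q).
Qed.

Lemma prime_filter_separation {a u} : ~ a <= u ->
  exists P, [/\ prime_filter P, P a & ~ P u].
Proof.
move=> au.
(* The empty set must qualify, being the union of the empty chain; hence only
   the nonempty candidates are required to contain [a]. *)
pose C X := [/\ forall x y, X x -> x <= y -> X y,
                 forall x y m, is_meet x y m -> X x -> X y -> X m,
                 X !=set0 -> X a & ~ X u].
have [|P [[Pup PI P0a Pu] maxP]] := @Zorn_bigcup _ C.
  move=> F FC Ftot; split.
  - move=> x y [X FX Xx] xy; exists X => //.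
    by have [Xup _ _ _] := FC X FX; apply: Xup xy.
  - move=> x y m xym [X FX Xx] [Y FY Yy].
    have [XY|YX] := Ftot X Y FX FY.
      exists Y => //; have [_ YI _ _] := FC Y FY.
      by apply: (YI x y m) => //; apply: XY.
    exists X => //; have [_ XI _ _] := FC X FX.
    by apply: (XI x y m) => //; apply: YX.
  - move=> [x [X FX Xx]]; exists X => //.
    by have [_ _ Xa _] := FC X FX; apply: Xa; exists x.
  - by move=> [X FX Xu]; have [_ _ _] := FC X FX; apply.
have Ca : C [set x | a <= x].
  by have [_ up I] := principal_filter a; split=> //= _.
have Pa : P a.
  apply: contrapT => Pa; apply: maxP Ca; split.
    by move=> x Px; exfalso; apply: Pa; apply: P0a; exists x.
  by move=> /(_ a (lexx a)).
exists P; split=> //; apply: (@maximal_filter_prime P u) => //.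
  by split=> //; exists a.
move=> F [_ Fup FI] PF; apply: contrapT => Fu; apply: (maxP F PF); split=> // _.
exact: PF.1.
Qed.

End Filters.

(** * The envelope and the sublattice generated by a D-base *)

Section DBase.
Local Open Scope order_scope.
Local Open Scope classical_set_scope.
Import Order.Theory.
Context {d} {L : frameType d} {A : set L}.
Hypothesis hA : D_base A.
Let base : frame_base A. Proof. by case: hA. Qed.
Let dA : distributive_meet_semilattice (set_type A). Proof. by case: hA. Qed.
Let supA : sup_morphism (val : set_type A -> L). Proof. by case: hA. Qed.
Implicit Types (a b : set_type A) (S : set (set_type A)) (y z : L).
Implicit Types (U V : set (set_type (prime_filters (set_type A)))).

(** The bridge between the two orders: the prime filter theorem turns inclusion of
basic sets into a join computed in [A], and the sup-morphism condition carries
that join to [L]. *)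
Lemma stone_sub_bigcupP a S y : finite_set S -> S !=set0 ->
  supremums (val @` S) y ->
  stone a `<=` \bigcup_(b in S) stone b <-> val a <= y.
Proof.
move=> Sfin S0 [uy ly]; split=> [aS|ay P Pa]; last first.
  have /set_mem Pprime := valP P.
  have [_ up _] : order_filter (val P) by case: Pprime.
  have [|b Sb Pb] := prime_filter_ubound dA Pprime Sfin S0; last by exists b.
  move=> u Su; apply: up Pa _; apply: le_trans ay _.
  by apply: ly => _ [b Sb <-]; exact: Su.
have above u : ubound S u -> a <= u.
  move=> Su; apply: contrapT => /(prime_filter_separation dA)[P [Pprime Pa Pu]].
  pose Q : set_type (prime_filters (set_type A)) := SigSub (mem_set Pprime).
  have [//|b Sb Pb] := aS Q.
  have [[_ up _] _ _] := Pprime.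
  by apply: Pu; apply: up (Su b Sb).
have /choice[f fP] : forall b, exists m, [/\ m <= a, m <= b & meet_le a b m].
  by move=> b; exact: meet_exists dA a b.
(* Any bound [v] of these meets is above [a /\ w] for some common bound [w] of
   [S], and [a /\ w] is [a] by [above]. *)
have supa : supremums (f @` S) a.
  split=> [_ [b _ <-]|v fv]; first by have [] := fP b.
  have [|w Sw awv] := meet_le_ubound dA S a v Sfin S0.
  - move=> b Sb x xa xb; have [_ _ abf] := fP b.
    by apply: le_trans (abf x xa xb) _; apply: fv; exists b.
  - by apply: awv => //; apply: above.
have [_ lub] := supA.2 (f @` S) a (finite_image f Sfin) supa.
apply: lub => _ [_ [b Sb <-] <-]; have [_ fb _] := fP b.
by apply: le_trans (uy _ _); [exact: fb|exists b].
Qed.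

(** The graph of the isomorphism. As a relation it needs no chosen family [S];
that it is functional and injective follows from [match_le]. *)
Definition envelope_match U y : Prop :=
  exists S, [/\ finite_set S, S !=set0, U = \bigcup_(b in S) stone b &
                supremums (val @` S) y].

Lemma stone_sub_matchP {U y} : envelope_match U y ->
  forall a, stone a `<=` U <-> val a <= y.
Proof. by move=> [S [Sfin S0 -> Sy]] a; exact: stone_sub_bigcupP. Qed.

Lemma envelopeP U :
  distributive_envelope (set_type A) U <-> exists y, envelope_match U y.
Proof.
rewrite distributive_envelopeE; last exact: dA.1.
split=> [[S [Sfin S0] <-]|[y [S [Sfin S0 -> _]]]]; last by exists S.
by have [y Sy] := frame_has_sup (val @` S); exists y, S.
Qed.

Lemma match_le {U V y z} : envelope_match U y -> envelope_match V z ->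
  U `<=` V <-> y <= z.
Proof.
move=> Uy Vz; split=> [UV|yz].
  have [S [_ _ US [_ ly]]] := Uy; apply: ly => _ [b Sb <-].
  apply/(stone_sub_matchP Vz); apply: subset_trans UV.
  by rewrite US; apply: bigcup_sup.
have [S [_ _ US _]] := Uy; rewrite {1}US; apply: bigcup_sub => b Sb.
apply/(stone_sub_matchP Vz); apply: le_trans yz; apply/(stone_sub_matchP Uy).
by rewrite US; apply: bigcup_sup.
Qed.

Lemma match_join {U V y z} : envelope_match U y -> envelope_match V z ->
  envelope_match (U `|` V) (Order.join y z).
Proof.
move=> [S [Sfin S0 -> Sy]] [T [Tfin [t Tt] -> Tz]]; exists (S `|` T); split.
- by rewrite finite_setU.
- by exists t; right.
- by rewrite bigcup_setU.
- by rewrite image_setU; exact: supremumsU.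
Qed.

(** The envelope is closed under intersections, so [U `&` V] matches some [t];
[t] and the meet of [y] and [z] have the same elements of [A] below them, and
[A] is a base. *)
Lemma match_meet {U V y z} : envelope_match U y -> envelope_match V z ->
  envelope_match (U `&` V) (Order.meet y z).
Proof.
move=> Uy Vz.
have [t UVt] : exists t, envelope_match (U `&` V) t.
  apply/envelopeP => M [Msub AM].
  have /(_ M) MU : distributive_envelope (set_type A) U
    by apply/envelopeP; exists y.
  have /(_ M) MV : distributive_envelope (set_type A) V
    by apply/envelopeP; exists z.
  by have [] := Msub U V (MU (conj Msub AM)) (MV (conj Msub AM)).
suff <- : t = Order.meet y z by [].
apply/le_anti/andP; split.
  rewrite lexI; apply/andP; split.
    by apply/(match_le UVt Uy); exact: subIsetl.
  by apply/(match_le UVt Vz); exact: subIsetr.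
have [S SA [uS lS]] := base (Order.meet y z); apply: lS => x Sx.
have := uS x Sx; rewrite lexI => /andP[xy xz].
pose a : set_type A := SigSub (mem_set (SA x Sx)).
apply/(stone_sub_matchP UVt a); rewrite subsetI; split.
  exact/(stone_sub_matchP Uy a).
exact/(stone_sub_matchP Vz a).
Qed.

Lemma generated_sublatticeP y :
  generated_sublattice A y <-> exists U, envelope_match U y.
Proof.
split=> [Ay|[U [S [Sfin S0 _ Sy]]]]; last first.
  apply: finite_sup_generated Sy; first exact: finite_image.
    by have [a Sa] := S0; exists (val a), a.
  by move=> _ [a _ <-]; exact: set_mem (valP a).
apply: (Ay [set z | exists U, envelope_match U z]); split.
  move=> x z [U Ux] [V Vz]; split.
    by exists (U `&` V); exact: match_meet.
  by exists (U `|` V); exact: match_join.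
move=> x Ax; pose a : set_type A := SigSub (mem_set Ax).
exists (stone a), [set a]; split; [exact: finite_set1|by exists a| |].
  by rewrite bigcup_set1.
by rewrite image_set1 supremums1.
Qed.

(** The join of all elements of [A] lying below [U], rather than of a family
representing [U]: this makes the map independent of any choice of family. *)
Definition envelope_join U : L :=
  sval (cid (frame_has_sup (val @` [set a | stone a `<=` U]))).

Lemma envelope_joinE {U y} : envelope_match U y -> envelope_join U = y.
Proof.
move=> Uy; rewrite /envelope_join; case: cid => t /= Ut.
apply: (is_subset1_supremums Ut).
split=> [_ [a /= aU <-]|x xub]; first exact/(stone_sub_matchP Uy).
have [S [_ _ US [_ ly]]] := Uy; apply: ly => _ [b Sb <-].
by apply: xub; exists b => //=; rewrite US; apply: bigcup_sup.
Qed.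

Lemma envelope_join_match {U} : distributive_envelope (set_type A) U ->
  envelope_match U (envelope_join U).
Proof. by move=> /envelopeP[y Uy]; rewrite (envelope_joinE Uy). Qed.

End DBase.

Theorem theorem5p6 (d : Order.disp_t) (L : frameType d) (A : set L)
  (hA : D_base A) :
  lattice_isomorphic (distributive_envelope (set_type A))
                     (generated_sublattice A).
Proof.
exists envelope_join; split.
- split.
  + move=> U /(envelope_join_match hA) Uy.
    by apply/(generated_sublatticeP hA); exists U.
  + move=> U V /set_mem /(envelope_join_match hA) Uy.
    move=> /set_mem /(envelope_join_match hA) Vz yz.
    apply/seteqP; split.
      by apply/(match_le hA Uy Vz); rewrite yz Order.POrderTheory.lexx.
    by apply/(match_le hA Vz Uy); rewrite yz Order.POrderTheory.lexx.
  + move=> y /(generated_sublatticeP hA)[U Uy].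
    exists U; last exact: (envelope_joinE hA).
    by apply/(envelopeP hA); exists y.
- move=> U V /set_mem /(envelope_join_match hA) Uy.
  move=> /set_mem /(envelope_join_match hA) Vz.
  exact: (envelope_joinE hA (match_meet hA Uy Vz)).
- move=> U V /set_mem /(envelope_join_match hA) Uy.
  move=> /set_mem /(envelope_join_match hA) Vz.
  exact: (envelope_joinE hA (match_join Uy Vz)).
Qed.
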